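(* Let $K$ be a field of characteristic $p>0$ and let $L/K$ be a finite field extension. Then: 1. $\mathcal{D}(L/K)=E(L/L_{dif})\simeq M_{[L:L_{dif}]}(L_{dif})$ is a central simple finite dimensional $L_{dif}$-algebra, $\mathrm{Deg}(\mathcal{D}(L/K))=[L:L_{dif}]$ and $\dim_K(\mathcal{D}(L/K))=[L:L_{dif}]^2[L_{dif}:K]$. 2. $L\in\mathrm{Max}_s(\mathcal{D}(L/K))$. 3. $Z(\mathcal{D}(L/K))=L_{dif}$. 4. $L$ is the only (up to isomorphism) simple $\mathcal{D}(L/K)$-module. 5. $\mathrm{End}_{\mathcal{D}(L/K)}(L)=L_{dif}$. 6. $C_{E(L/K)}(\mathcal{D}(L/K))=L_{dif}$ and $C_{E(L/K)}(L_{dif})=\mathcal{D}(L/K)$.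
   Context: For a finite field extension $L/K$: $E(L/K)=\mathrm{End}_K(L)$; $L$ is viewed as a subfield of $E(L/K)$ via multiplication operators. For an intermediate field $M$, $E(L/M)=\mathrm{End}_M(L)\subseteq E(L/K)$. $\mathcal{D}(L/K)=\bigcup_{i\ge0}\mathcal{D}_i\subseteq E(L/K)$ is the algebra of $K$-linear differential operators on $L$, where $\mathcal{D}_0=L$ and $\mathcal{D}_i=\{\delta\in E(L/K)\mid\delta l-l\delta\in\mathcal{D}_{i-1}\text{ for all }l\in L\}$. $L_{dif}=\{l\in L\mid l\delta=\delta l\text{ for all }\delta\in\mathcal{D}(L/K)\}$. $Z(A)$ is the centre of $A$ and $C_{E(L/K)}(S)$ the centralizer of $S$ in $E(L/K)$. Modules are left modules. For a central simple finite dimensional algebra $A$ over a field $F$, $\mathrm{Deg}(A)=\sqrt{\dim_F A}$, and $\mathrm{Max}_s(A)$ is the set of subfields $N\supseteq F$ of $A$ with $[N:F]=\mathrm{Deg}(A)$. *)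

(* Defs.v *)
From HB Require Import structures.
From mathcomp Require Import all_boot all_order all_algebra all_field.

Set Implicit Arguments.
Unset Strict Implicit.
Unset Printing Implicit Defensive.
Import Order.TTheory GRing.Theory Num.Theory.
Local Open Scope ring_scope.

Definition is_submodule (R : nzRingType) (V : lmodType R) (S : V -> Prop) :=
  S 0 /\ forall (a : R) (u v : V), S u -> S v -> S (a *: u + v).

Definition simple_module (R : nzRingType) (V : lmodType R) : Prop :=
  (exists v : V, v != 0) /\
  forall S : V -> Prop, is_submodule S ->
    (forall v, S v -> v = 0) \/ (forall v, S v).

Definition module_iso (R : nzRingType) (V W : lmodType R) : Prop :=
  exists f : {linear V -> W}, bijective f.

Definition two_sided_ideal (R : nzRingType) (I : R -> Prop) :=
  [/\ I 0, forall x y, I x -> I y -> I (x + y)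
    & forall a x b, I x -> I (a * x * b)].

Definition simple_ring (R : nzRingType) : Prop :=
  forall I : R -> Prop, two_sided_ideal I ->
    (forall x, I x -> x = 0) \/ (forall x, I x).

(* Finite dimensionality and A != 0 are part of falgType. *)
Definition central_simple (F : fieldType) (A : falgType F) : Prop :=
  'Z({:A})%VS = 1%VS /\ simple_ring A.

(* The square root is taken in algC, so that no rounding is involved. *)
Definition Deg (F : fieldType) (A : falgType F) : algC :=
  sqrtC (\dim {:A})%:R.

(* The subspace 1 is the image F * 1 of the base field. *)
Definition is_subfield (F : fieldType) (A : falgType F) (N : {vspace A}) :=
  [/\ (1 <= N)%VS, {in N &, forall x y, x * y \in N},
      {in N &, forall x y, x * y = y * x}
    & {in N, forall x, x != 0 -> exists2 y, y \in N & x * y = 1}].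

Definition Max_s (F : fieldType) (A : falgType F) (N : {vspace A}) : Prop :=
  is_subfield N /\ (\dim N)%:R = Deg A.

(* FalgLfun makes f * g stand for g \o f, which would turn left modules into
   right modules; here f * g is f \o g. *)
Definition endo (K : fieldType) (L : fieldExtType K) := 'End(L).

Identity Coercion lfun_of_endo : endo >-> hom.

Section Endo.

Variables (K : fieldType) (L : fieldExtType K).
Local Notation E := (endo L).

HB.instance Definition _ := Vector.on E.
HB.instance Definition _ := GRing.Zmodule_isNzRing.Build E
  (@comp_lfunA _ L L L L) (@comp_lfun1l _ L L) (@comp_lfun1r _ L L)
  (@comp_lfunDl _ L L L) (@comp_lfunDr _ L L L)
  (lfun1_neq0 (FalgType_proper L)).
HB.instance Definition _ := GRing.Lmodule_isLalgebra.Build K E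
  (@comp_lfunZl _ L L L).
HB.instance Definition _ := GRing.Lalgebra_isAlgebra.Build K E
  (@comp_lfunZr _ L L L).
HB.instance Definition _ := Algebra_isFalgebra.Build K E.

Lemma endo_mulE (f g : E) x : (f * g) x = f (g x).
Proof. exact: comp_lfunE. Qed.

Lemma endo_oneE x : (1 : E) x = x.
Proof. exact: id_lfunE. Qed.

Definition mulop (l : L) : E := amull l.

Lemma mulopE l x : mulop l x = l * x.
Proof. by rewrite /mulop lfunE. Qed.

Fact mulop_is_linear : linear mulop.
Proof. by move=> a u v; rewrite /mulop linearP. Qed.
Fact mulop_is_monoid_morphism : monoid_morphism mulop.
Proof. by split=> [|u v]; rewrite /mulop ?amull1 ?amullM. Qed.
HB.instance Definition _ := GRing.isLinear.Build K L E _ mulop mulop_is_linear.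
HB.instance Definition _ :=
  GRing.isMonoidMorphism.Build L E mulop mulop_is_monoid_morphism.

Lemma mulop_inj : injective mulop.
Proof. exact: amull_inj. Qed.

Definition mulopv (M : {vspace L}) : {vspace E} := (linfun mulop @: M)%VS.

Lemma mulopvP (M : {vspace L}) (f : E) :
  reflect (exists2 l, l \in M & f = mulop l) (f \in mulopv M).
Proof.
by apply: (iffP memv_imgP) => -[l Ml ->]; exists l; rewrite ?lfunE.
Qed.

(* Membership in E(L/M): fieldOver M is L with its M-algebra structure. *)
Definition endo_over (M : {subfield L}) (f : E) : Prop :=
  linear (f : fieldOver M -> fieldOver M).

Lemma endo_overP (M : {subfield L}) (f : E) :
  endo_over M f <-> {in M, forall c x, f (c * x) = c * f x}.
Proof.
split=> [lin_f c Mc x | lin_f a x y].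
  by have:= lin_f (Subvs Mc) x 0; rewrite linear0 !addr0 fieldOver_scaleE.
rewrite !fieldOver_scaleE [LHS]linearD; congr (_ + _).
exact: lin_f (valP a) x.
Qed.

Fixpoint diffop_le (i : nat) (f : E) : Prop :=
  if i is j.+1 then forall l, diffop_le j (f * mulop l - mulop l * f)
  else exists l, f = mulop l.

Definition is_diffop (f : E) : Prop := exists i, diffop_le i f.

(* The same filtration by subspaces (see diffsP); since brackets are linear in
   l, it is enough to test them on a basis of L. *)
Definition bracket (l : L) : 'End(E) := amulr (mulop l) - amull (mulop l).

Lemma bracketE l f : bracket l f = f * mulop l - mulop l * f.
Proof. by rewrite /bracket add_lfunE opp_lfunE !lfunE. Qed.

Fixpoint diffs (i : nat) : {vspace E} :=
  if i is j.+1 then (\bigcap_(b <- vbasis {:L}) (bracket b @^-1: diffs j))%VS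
  else mulopv {:L}.

Lemma diffsS i f :
  reflect (forall l, bracket l f \in diffs i) (f \in diffs i.+1).
Proof.
have memb b : (f \in bracket b @^-1: diffs i)%VS = (bracket b f \in diffs i).
  by rewrite memv_preim.
have memcap s : (f \in \bigcap_(b <- s) (bracket b @^-1: diffs i))%VS
    = all (fun b => bracket b f \in diffs i) s.
  elim: s => [|b s IHs] /=; first by rewrite big_nil memvf.
  by rewrite big_cons memv_cap memb IHs.
rewrite /= memcap; apply: (iffP allP) => [brf l | brf b _]; last exact: brf.
rewrite (coord_vbasis (memvf l)).
have -> : bracket (\sum_i coord (vbasis {:L}) i l *: (vbasis {:L})`_i) f
    = \sum_i coord (vbasis {:L}) i l *: bracket (vbasis {:L})`_i f.
  rewrite bracketE linear_sum mulr_sumr mulr_suml -sumrB.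
  apply: eq_bigr => j _.
  by rewrite bracketE linearZ /= -scalerAr -scalerAl -scalerBr.
by apply: memv_suml => j _; rewrite memvZ // brf // memt_nth.
Qed.

Lemma diffsP i f : f \in diffs i <-> diffop_le i f.
Proof.
elim: i f => [|i IHi] f /=.
  split=> [/mulopvP[l _ ->] | [l ->]]; first by exists l.
  by apply/mulopvP; exists l; rewrite ?memvf.
split=> [/diffsS brf l | brf]; first by apply/IHi; rewrite -bracketE.
by apply/diffsS => l; apply/IHi; rewrite bracketE.
Qed.

Lemma diffs_subS i : (diffs i <= diffs i.+1)%VS.
Proof.
elim: i => [|i IHi]; apply/subvP=> f.
  case/mulopvP=> l _ ->; apply/diffsS => m.
  by rewrite bracketE -!rmorphM mulrC subrr mem0v.
by move/diffsS=> brf; apply/diffsS => l; apply: (subvP IHi).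
Qed.

Lemma diffs_sub i j : (i <= j)%N -> (diffs i <= diffs j)%VS.
Proof.
elim: j => [|j IHj]; first by rewrite leqn0 => /eqP->.
rewrite leq_eqVlt => /predU1P[-> // | /IHj sij].
exact: subv_trans sij (diffs_subS j).
Qed.

Lemma diffs_stable i j : diffs i = diffs i.+1 -> diffs (i + j) = diffs i.
Proof.
move=> Di; elim: j => [|j IHj]; first by rewrite addn0.
rewrite addnS Di; apply/vspaceP=> f.
by apply/diffsS/diffsS => brf l; have:= brf l; rewrite IHj.
Qed.

(* An increasing chain of subspaces of E is stationary from \dim E on. *)
Lemma diffs_max i : (diffs i <= diffs (\dim {:E}))%VS.
Proof.
set n := \dim {:E}.
have [k [le_kn Dk]] : exists k, (k <= n)%N /\ diffs k = diffs k.+1.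
  have [/existsP[k /eqP Dk] | /existsPn neD] :=
      boolP [exists k : 'I_n.+1, diffs k == diffs k.+1].
    by exists k; rewrite -ltnS ltn_ord.
  have lt_dim k : (k <= n.+1)%N -> (k <= \dim (diffs k))%N.
    elim: k => // k IHk lt_kn; apply: leq_ltn_trans (IHk (ltnW lt_kn)) _.
    have:= neD (Ordinal lt_kn); rewrite eqEdim diffs_subS /=.
    by rewrite -ltnNge.
  have:= lt_dim _ (leqnn _); rewrite ltnNge => /negP[].
  exact: dimvS (subvf _).
rewrite -(subnKC le_kn) diffs_stable //.
have [le_ik | /ltnW le_ki] := (leqP i k); first exact: diffs_sub.
by rewrite -(subnKC le_ki) diffs_stable.
Qed.

Definition diffopv : {vspace E} := diffs (\dim {:E}).

Lemma diffopvP f : f \in diffopv <-> is_diffop f.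
Proof.
split=> [/diffsP | [i /diffsP]]; first by exists (\dim {:E}).
exact: subvP (diffs_max i) f.
Qed.

Lemma mulop_diff l : mulop l \in diffopv.
Proof. by apply/diffopvP; exists 0%N, l. Qed.

Fact bracketM l f g : bracket l (f * g) = f * bracket l g + bracket l f * g.
Proof. by rewrite !bracketE mulrBr mulrBl !mulrA addrA subrK. Qed.

Lemma diffsM i j f g :
  f \in diffs i -> g \in diffs j -> f * g \in diffs (i + j).
Proof.
have [n] := ubnP (i + j); elim: n i j f g => // n IHn i j f g le_n fi gj.
have br0 l h : h \in diffs 0 -> bracket l h = 0.
  by case/mulopvP=> m _ ->; rewrite bracketE -!rmorphM mulrC subrr.
case: i j le_n fi gj => [|i] [|j] le_n fi gj.
- case/mulopvP: fi => l _ ->; case/mulopvP: gj => m _ ->.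
  by rewrite -rmorphM; apply/mulopvP; exists (l * m); rewrite ?memvf.
- apply/diffsS => l; rewrite bracketM (br0 l f) // mul0r addr0.
  by apply: (IHn 0%N j) => //; apply/diffsS: l.
- rewrite addn0 in le_n *; apply/diffsS => l.
  rewrite bracketM (br0 l g) // mulr0 add0r -[i]addn0.
  by apply: IHn => //; [rewrite addn0 | apply/diffsS: l].
- rewrite addSn; apply/diffsS => l; rewrite bracketM memvD //.
    rewrite -addSnnS; apply: IHn => //; last by apply/diffsS: l.
    by rewrite -ltnS -addnS.
  by apply: IHn => //; apply/diffsS: l.
Qed.

Fact diffop_is_aspace : is_aspace diffopv.
Proof.
rewrite /is_aspace has_algid1; last by rewrite -(rmorph1 mulop) mulop_diff.
apply/prodvP=> f g /diffopvP[i /diffsP fi] /diffopvP[j /diffsP gj].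
by apply/diffopvP; exists (i + j)%N; apply/diffsP/diffsM.
Qed.
Definition diffops : {aspace E} := ASpace diffop_is_aspace.

Lemma diffopsP f : f \in diffops <-> is_diffop f.
Proof. exact: diffopvP. Qed.

Definition Ldifv : {vspace L} := (linfun mulop @^-1: 'C(diffops))%VS.

Lemma LdifvP l :
  l \in Ldifv <-> forall f, is_diffop f -> mulop l * f = f * mulop l.
Proof.
rewrite -memv_preim lfunE /=; split=> [/centvP Cl f /diffopsP Df | Cl].
  by rewrite Cl.
by apply/centvP=> f /diffopsP Df; rewrite Cl.
Qed.

Fact Ldif_is_aspace : is_aspace Ldifv.
Proof.
rewrite /is_aspace has_algid1.
  apply/prodvP=> l m /LdifvP Cl /LdifvP Cm; apply/LdifvP=> f Df.
  by rewrite rmorphM -mulrA Cm // !mulrA Cl.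
by apply/LdifvP=> f _; rewrite rmorph1 mul1r mulr1.
Qed.
Definition Ldif : {subfield L} := ASpace Ldif_is_aspace.

Lemma LdifP l :
  l \in Ldif <-> forall f, is_diffop f -> mulop l * f = f * mulop l.
Proof. exact: LdifvP. Qed.

End Endo.

Section EmbedVect.

Import VectorInternalTheory.

Fact embed_vect_axiom (k : fieldType) (V : lmodType k) (W : vectType k)
    (h : {linear V -> W}) (e : seq V) :
    injective h ->
    (forall v, exists r : 'I_(size e) -> k, v = \sum_i r i *: e`_i) ->
  Vector.axiom (dim (subvs_of <<map h e>>%VS)) V.
Proof.
move=> h_inj e_gen; set U := <<map h e>>%VS.
have hU v : h v \in U.
  have [r ->] := e_gen v; rewrite linear_sum memv_suml // => i _.
  by rewrite linearZ memvZ // memv_span // map_f // mem_nth.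
exists (fun v => v2r (vsproj U (h v))).
  by move=> a u v; rewrite !linearP.
pose X := in_tuple (map h e).
pose v2r := @v2r k (subvs_of U).
have surj r : exists v, v2r (vsproj U (h v)) == r.
  have [u ->] : exists u, r = v2r u.
    by exists (r2v r); rewrite /v2r r2vK.
  have /(@coord_span _ _ _ X) Du : vsval u \in <<X>>%VS by apply: subvsP.
  exists (\sum_(i < size (map h e)) coord X i (vsval u) *: e`_i).
  apply/eqP; congr (v2r _); apply: val_inj; rewrite /= vsprojK ?hU //.
  rewrite [RHS]Du linear_sum; apply: eq_bigr => i _; rewrite linearZ /=.
  by congr (_ *: _); rewrite (nth_map 0) // -(size_map h).
exists (fun r => xchoose (surj r)) => [v | r]; last exact/eqP/(xchooseP (surj r)).
apply: h_inj; have /eqP := xchooseP (surj (v2r (vsproj U (h v)))).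
move/(can_inj (@v2rK _ _))/(congr1 vsval).
by rewrite !vsprojK ?hU.
Qed.

End EmbedVect.

(* The ring structure is that of subvs_of, hence composition in endo L, but
   the scalars are L_dif instead of K: c *: d is mulop c \o d. *)
Definition diffalg (K : fieldType) (L : fieldExtType K) :=
  subvs_of (diffops L).

Section DiffAlgebra.

Variables (K : fieldType) (L : fieldExtType K).
Local Notation E := (endo L).
Local Notation F := (subvs_of (Ldif L)).
Local Notation D := (diffalg L).

HB.instance Definition _ := GRing.UnitRing.on D.

Definition diff_fun (d : D) : E := vsval d.

Fact algid_diffops : algid (diffops L) = 1.
Proof. by apply/eqP; rewrite algid_eq1 -(rmorph1 (@mulop K L)) mulop_diff. Qed.

Lemma diff_fun1 : diff_fun 1 = 1.
Proof. exact: algid_diffops. Qed.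
Lemma diff_funM d e : diff_fun (d * e) = diff_fun d * diff_fun e.
Proof. by []. Qed.
Lemma diff_funD d e : diff_fun (d + e) = diff_fun d + diff_fun e.
Proof. by []. Qed.
Lemma diff_fun_inj : injective diff_fun.
Proof. exact: val_inj. Qed.

Definition mulD (l : L) : D := Subvs (mulop_diff l).

Lemma mulDE l : diff_fun (mulD l) = mulop l.
Proof. by []. Qed.

Fact mulDM l m : mulD (l * m) = mulD l * mulD m.
Proof. by apply: val_inj; rewrite /= rmorphM. Qed.
Fact mulDD l m : mulD (l + m) = mulD l + mulD m.
Proof. by apply: val_inj; rewrite /= rmorphD. Qed.
Fact mulD1 : mulD 1 = 1.
Proof. by apply: diff_fun_inj; rewrite mulDE rmorph1 diff_fun1. Qed.

Definition diffalg_scale (c : F) (d : D) : D := mulD (vsval c) * d.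

Fact diffalg_scaleA a b d :
  diffalg_scale a (diffalg_scale b d) = diffalg_scale (a * b) d.
Proof. by rewrite /diffalg_scale mulrA -mulDM. Qed.
Fact diffalg_scale1 : left_id 1 diffalg_scale.
Proof.
move=> d; rewrite /diffalg_scale (_ : vsval 1 = 1) ?mulD1 ?mul1r //.
exact: (@algid1 _ _ (Ldif L)).
Qed.
Fact diffalg_scaleDr : right_distributive diffalg_scale +%R.
Proof. by move=> a d e; apply: mulrDr. Qed.
Fact diffalg_scaleDl d : {morph diffalg_scale^~ d : a b / a + b}.
Proof. by move=> a b; rewrite /diffalg_scale raddfD mulDD mulrDl. Qed.
HB.instance Definition _ := GRing.Zmodule_isLmodule.Build F D
  diffalg_scaleA diffalg_scale1 diffalg_scaleDr diffalg_scaleDl.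

Lemma diffalg_scaleE (a : F) (d : D) : a *: d = mulD (vsval a) * d.
Proof. by []. Qed.

Fact diffalg_scaleAl (a : F) (d e : D) : a *: (d * e) = (a *: d) * e.
Proof. exact: mulrA. Qed.
HB.instance Definition _ := GRing.Lmodule_isLalgebra.Build F D diffalg_scaleAl.

Fact diffalg_scaleAr (a : F) (d e : D) : a *: (d * e) = d * (a *: e).
Proof.
rewrite !diffalg_scaleE !mulrA; congr (_ * e); apply: diff_fun_inj.
rewrite !diff_funM mulDE; have /LdifP -> // := valP a.
exact/diffopsP/(valP d).
Qed.
HB.instance Definition _ := GRing.Lalgebra_isAlgebra.Build F D diffalg_scaleAr.


Local Notation ev_space :=
  {ffun 'I_(\dim {:L}) -> fieldOver (Ldif L)}.

Definition diffalg_ev (d : D) : ev_space :=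
  [ffun i : 'I_(\dim {:L}) => (diff_fun d (vbasis {:L})`_i : fieldOver (Ldif L))].

Fact diffalg_ev_linear : linear diffalg_ev.
Proof.
move=> a d e; apply/ffunP=> i; rewrite !ffunE diff_funD add_lfunE.
by rewrite diffalg_scaleE diff_funM endo_mulE mulDE mulopE.
Qed.
HB.instance Definition _ :=
  GRing.isLinear.Build F D ev_space _ diffalg_ev diffalg_ev_linear.

Fact diffalg_ev_inj : injective diffalg_ev.
Proof.
move=> d e /ffunP eq_de; apply: diff_fun_inj; apply/lfunP => x.
rewrite (coord_vbasis (memvf x)) !linear_sum; apply: eq_bigr => i _.
by rewrite !linearZ; congr (_ *: _); have:= eq_de i; rewrite !ffunE.
Qed.

Definition diffalg_gens : seq D := vbasis {:subvs_of (diffops L)}.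

Fact diffalg_gensP (d : D) :
  exists r : 'I_(size diffalg_gens) -> F,
    d = \sum_i r i *: diffalg_gens`_i.
Proof.
rewrite /diffalg_gens size_tuple.
have FK (a : K) : a%:A \in Ldif L by rewrite memvZ ?mem1v.
exists (fun i => Subvs (FK (coord (vbasis {:subvs_of (diffops L)}) i d))).
rewrite {1}(coord_vbasis (memvf (d : subvs_of (diffops L)))).
apply: eq_bigr => i _; apply: diff_fun_inj.
rewrite diffalg_scaleE diff_funM mulDE /= linearZ /= rmorph1.
by rewrite -scalerAl mul1r.
Qed.

HB.instance Definition _ := Lmodule_hasFinDim.Build F D
  (embed_vect_axiom diffalg_ev_inj diffalg_gensP).

Fact mulD_is_linear : linear (mulD : fieldOver (Ldif L) -> D).
Proof.
by move=> a l m; rewrite fieldOver_scaleE mulDD mulDM diffalg_scaleE.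
Qed.
HB.instance Definition _ :=
  GRing.isLinear.Build F (fieldOver (Ldif L)) D _
    (mulD : fieldOver (Ldif L) -> D) mulD_is_linear.

Definition L_in_D : {vspace D} :=
  limg (linfun (mulD : fieldOver (Ldif L) -> D)).

Lemma L_in_DP d : reflect (exists l : L, d = mulD l) (d \in L_in_D).
Proof.
apply: (iffP memv_imgP) => [[l _ ->] | [l ->]]; exists l; rewrite ?memvf //.
  by rewrite lfunE.
by rewrite lfunE.
Qed.

End DiffAlgebra.

(* L with scalar multiplication d *: x = d x. *)
Definition diffmod (K : fieldType) (L : fieldExtType K) : Type := L.

Section DiffModule.

Variables (K : fieldType) (L : fieldExtType K).
Local Notation D := (diffalg L).
Local Notation V := (diffmod L).

HB.instance Definition _ := GRing.Zmodule.on V.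

Definition diffmod_scale (d : D) (x : V) : V := diff_fun d x.

Fact diffmod_scaleA d e x :
  diffmod_scale d (diffmod_scale e x) = diffmod_scale (d * e) x.
Proof. by rewrite /diffmod_scale diff_funM endo_mulE. Qed.
Fact diffmod_scale1 : left_id 1 diffmod_scale.
Proof. by move=> x; rewrite /diffmod_scale diff_fun1 endo_oneE. Qed.
Fact diffmod_scaleDr : right_distributive diffmod_scale +%R.
Proof. by move=> d x y; rewrite /diffmod_scale [LHS]linearD. Qed.
Fact diffmod_scaleDl x : {morph diffmod_scale^~ x : d e / d + e}.
Proof. by move=> d e; rewrite /diffmod_scale diff_funD [LHS]add_lfunE. Qed.
HB.instance Definition _ := GRing.Zmodule_isLmodule.Build D V
  diffmod_scaleA diffmod_scale1 diffmod_scaleDr diffmod_scaleDl.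

Lemma diffmod_scaleE (d : D) (x : V) : d *: x = diff_fun d x.
Proof. by []. Qed.

End DiffModule.

(* Main.v *)
(* D = D(L/K) contains L, so L is a simple D-module, and D-endomorphisms of L
   are the multiplications by elements of L_dif. By Jacobson density, for an
   L_dif-basis b of L there are e_i in D with e_i b_j = delta_ij; hence D
   consists of all L_dif-linear operators, and every other claim is read off
   from the e_i. *)
Require Import Defs.
From HB Require Import structures.
From mathcomp Require Import all_boot all_order all_algebra all_field.
From Stdlib Require Import Classical.

Set Implicit Arguments.
Unset Strict Implicit.
Unset Printing Implicit Defensive.
Import Order.TTheory GRing.Theory Num.Theory.
Local Open Scope ring_scope.

(** * Linear algebra preliminaries *)

Lemma free_notin_span (k : fieldType) (V : vectType k) (n : nat)
    (X : n.-tuple V) (i : 'I_n) :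
  free X -> X`_i \notin <<[seq X`_j | j : 'I_n in predC1 i]>>%VS.
Proof.
move=> freeX; apply/negP.
(* The form [coord X i] kills the other vectors but takes the value 1 at the i-th. *)
have s_ker : (<<[seq X`_j | j : 'I_n in predC1 i]>>
    <= lker (linfun (coord X i : V -> k^o)))%VS.
  apply/span_subvP=> _ /imageP[j ne_ji ->].
  by rewrite memv_ker lfunE /= coord_free // eq_sym (negPf ne_ji).
move/(subvP s_ker); rewrite memv_ker lfunE /= coord_free // eqxx.
by rewrite oner_eq0.
Qed.

Lemma bij_of_inj_surj (T U : choiceType) (f : T -> U) :
  injective f -> (forall u, exists t, f t = u) -> bijective f.
Proof.
move=> f_inj f_surj.
have f_surjb u : exists t, f t == u by have [t <-] := f_surj u; exists t.
have gK u : f (xchoose (f_surjb u)) = u by apply/eqP/(xchooseP (f_surjb u)).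
by exists (fun u => xchoose (f_surjb u)) => // t; apply: f_inj; rewrite gK.
Qed.

Lemma dim_bij_linear (k : fieldType) (V W : vectType k)
    (f : {linear V -> W}) : bijective f -> \dim {:V} = \dim {:W}.
Proof.
move=> [g fK gK]; rewrite -(@limg_dim_eq _ _ _ (linfun f) {:V}).
  congr (\dim _); apply/vspaceP=> w; rewrite memvf.
  by apply/memv_imgP; exists (g w); rewrite ?memvf // lfunE /= gK.
apply/eqP; rewrite capfv; apply/lker0P => u v.
by rewrite !lfunE; apply: can_inj fK u v.
Qed.

Lemma dim_ffun (k : fieldType) (V : vectType k) (I : finType) :
  \dim {: {ffun I -> V}} = (#|I| * \dim {:V})%N.
Proof. by rewrite !dimvf. Qed.

Section Density.

Variables (K : fieldType) (L : fieldExtType K).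
Local Notation E := (endo L).
Local Notation F := (subvs_of (Ldif L)).
Local Notation LM := (fieldOver (Ldif L)).

(** * Density of D in the L_dif-linear operators *)

Lemma diffops_Ldif_linear (d : E) c x :
  d \in diffops L -> c \in Ldif L -> d (c * x) = c * d x.
Proof.
move=> /diffopsP Dd /LdifP/(_ _ Dd)/(congr1 (fun f : E => f x)).
by rewrite !endo_mulE !mulopE.
Qed.

Lemma Ldif_of_linear (c : L) :
  (forall d x, d \in diffops L -> d (c * x) = c * d x) -> c \in Ldif L.
Proof.
move=> lin_c; apply/LdifP=> d /diffopsP Dd; apply/lfunP=> x.
by rewrite !endo_mulE !mulopE lin_c.
Qed.

(* Jacobson density: if some d0 in D kills s and d0 w = 1, then c = d0 x lies
   in L_dif and d x = d (c w) for every d in D killing s. *)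
Lemma annihilator_span (s : seq LM) (x : LM) :
    (forall d : E, d \in diffops L -> {in s, forall y : LM, d y = 0} ->
       d x = 0) ->
  x \in <<s>>%VS.
Proof.
elim: s x => [|w s IHs] x ann_x.
  have /= := ann_x (mulop 1) (mulop_diff 1).
  by rewrite mulopE mul1r => -> //; apply: mem0v.
have [[d1 [Dd1 d1s /eqP d1w]] | ann_w] := classic (exists d1 : E,
      [/\ d1 \in diffops L, {in s, forall y : LM, d1 y = 0} & d1 w <> 0]);
  last first.
  (* Here every [d] in D killing [s] kills [w] too, so the hypothesis passes to [s] alone. *)
  rewrite span_cons (subvP (addvSr _ _)) ?IHs // => d Dd ds.
  apply: ann_x => // y /predU1P[-> | /ds //].
  by apply: NNPP => dw; case: ann_w; exists d.
pose d0 := mulop (d1 w)^-1 * d1.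
have Dd0 : d0 \in diffops L by rewrite memvM ?mulop_diff.
have d0s : {in s, forall y : LM, d0 y = 0}.
  by move=> y sy; rewrite endo_mulE mulopE (d1s y) ?mulr0.
have d0w : d0 w = 1 by rewrite endo_mulE mulopE mulVf.
clearbody d0; pose c := d0 x.
have dx (d : E) : d \in diffops L -> {in s, forall y : LM, d y = 0} ->
    d x = d w * c.
  (* [d - mulop (d w) * d0] lies in D and kills [w :: s], hence also [x]. *)
  move=> Dd ds; apply/eqP; rewrite -subr_eq0; apply/eqP.
  have evE y : (d - mulop (d w) * d0) y = d y - d w * d0 y.
    by rewrite add_lfunE opp_lfunE endo_mulE mulopE.
  rewrite -evE; apply: ann_x => [|y sy].
    by rewrite memvB ?memvM ?mulop_diff.
  rewrite evE.
  case/predU1P: sy => [-> | sy]; first by rewrite d0w mulr1 subrr.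
  by rewrite ds // d0s // mulr0 subr0.
have Mc : c \in Ldif L.
  (* Apply [dx] to [d * (mulop y * d0)], which sends [x] to d (y c) and [w] to d y. *)
  apply: Ldif_of_linear => d y Dd.
  have evE z : (d * (mulop y * d0)) z = d (y * d0 z).
    by rewrite !endo_mulE mulopE.
  rewrite mulrC -evE dx ?evE ?d0w ?mulr1; first exact: mulrC.
    by rewrite !memvM ?mulop_diff.
  by move=> z sz; rewrite evE d0s // mulr0 linear0.
rewrite span_cons -[x](subrK ((Subvs Mc : F) *: w)) addrC memv_add //.
  by rewrite memvZ ?memv_line.
apply: IHs => d Dd ds.
rewrite fieldOver_scaleE /= linearB /= diffops_Ldif_linear // dx //.
by rewrite mulrC subrr.
Qed.

Local Notation m := (\dim {:LM}).
Local Notation b := (vbasis {:LM}).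

(** Links the size of the basis [b] to the degree [L : L_dif]. *)
Lemma dim_fieldOver_Ldif : m = \dim_(Ldif L) {:L}.
Proof.
rewrite -dim_aspaceOver ?subvf //; congr (\dim _).
apply/vspaceP=> x; rewrite mem_aspaceOver ?subvf //.
by rewrite [LHS]memvf [RHS]memvf.
Qed.

(** As b_i is outside the span of the other basis vectors, density gives an operator in D killing
    these but not b_i; a multiplication by an element of L rescales its value at b_i to 1. *)
Lemma dual_basis_exists :
  exists d : 'I_m -> E, forall i, d i \in diffops L /\
    forall j : 'I_m, d i b`_j = (i == j)%:R.
Proof.
apply: (fin_all_exists (P := fun i (d : E) => d \in diffops L /\
  forall j : 'I_m, d b`_j = (i == j)%:R)) => i.
pose s : seq LM := [seq b`_j | j : 'I_m in predC1 i].
have fb : free b by apply: basis_free (vbasisP _).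
apply: NNPP => no_d.
have : b`_i \in <<s>>%VS.
  apply: annihilator_span => d Dd ds; apply: NNPP => /eqP dbi; case: no_d.
  exists (mulop (d b`_i)^-1 * d); split; first by rewrite memvM ?mulop_diff.
  move=> j; rewrite endo_mulE mulopE; have [<- | ne_ij] := eqVneq i j.
    by rewrite mulVf.
  by rewrite (ds b`_j) ?mulr0 //; apply: image_f; rewrite inE eq_sym.
by apply/negP/free_notin_span.
Qed.


(** * D as all L_dif-linear operators, as matrices, and its dimensions *)

Lemma Ldif_linear_eq (f g : E) :
    {in Ldif L, forall c x, f (c * x) = c * f x} ->
    {in Ldif L, forall c x, g (c * x) = c * g x} ->
  (forall j : 'I_m, f b`_j = g b`_j) -> f = g.
Proof.
move=> lin_f lin_g fg; apply/lfunP=> x.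
have := coord_vbasis (memvf (x : LM)) => ->.
have expand (h : E) (c : 'I_m -> F) :
    {in Ldif L, forall c x, h (c * x) = c * h x} ->
    h (\sum_j c j *: (b`_j : LM)) = \sum_j vsval (c j) * h b`_j.
  move=> lin_h; rewrite linear_sum; apply: eq_bigr => j _.
  by rewrite fieldOver_scaleE /= lin_h ?(valP (c j)).
by rewrite !expand //; apply: eq_bigr => j _; rewrite fg.
Qed.

(** Images of basis vectors form the columns, so that composition in D becomes the matrix product
    without a transpose. *)
Definition diff_mx (d : diffalg L) : 'M[F]_m :=
  \matrix_(i, j) coord b i (diff_fun d b`_j : LM).

Lemma diff_fun_in (d : diffalg L) : diff_fun d \in diffops L.
Proof. exact: valP d. Qed.

Lemma diff_fun_Ldif_linear (d : diffalg L) :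
  {in Ldif L, forall c x, diff_fun d (c * x) = c * diff_fun d x}.
Proof. by move=> c Mc x; apply: diffops_Ldif_linear (diff_fun_in d) Mc. Qed.

Lemma diff_fun_sum (I : finType) (d : I -> diffalg L) :
  diff_fun (\sum_i d i) = \sum_i diff_fun (d i).
Proof. exact: (raddf_sum (vsval : subvs_of (diffops L) -> E)). Qed.

Lemma diff_fun_scale (a : F) (d : diffalg L) x :
  diff_fun (a *: d) x = vsval a * diff_fun d x.
Proof. by rewrite diffalg_scaleE diff_funM endo_mulE mulDE mulopE. Qed.

Fact diff_mx_is_linear : linear diff_mx.
Proof.
move=> a d e; apply/matrixP=> i j.
rewrite !mxE diff_funD add_lfunE diff_fun_scale.
exact: linearP.
Qed.
HB.instance Definition _ :=
  GRing.isLinear.Build F (diffalg L) 'M[F]_m _ diff_mx diff_mx_is_linear.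

Fact diff_mx_is_monoid_morphism : monoid_morphism diff_mx.
Proof.
split=> [|d e]; apply/matrixP=> i j.
  rewrite !mxE diff_fun1 endo_oneE coord_free ?(basis_free (vbasisP _)) //.
  by rewrite eq_sym.
rewrite !mxE diff_funM endo_mulE.
have := coord_vbasis (memvf (diff_fun e b`_j : LM)) => ->.
rewrite linear_sum.
transitivity (coord b i (\sum_l coord b l (diff_fun e b`_j : LM) *:
    (diff_fun d b`_l : LM))).
  congr (coord b i _); apply: eq_bigr => l _.
  by rewrite fieldOver_scaleE /= diff_fun_Ldif_linear ?fieldOver_scaleE ?subvsP.
by rewrite linear_sum; apply: eq_bigr => l _; rewrite !mxE linearZ mulrC.
Qed.
HB.instance Definition _ := GRing.isMonoidMorphism.Build (diffalg L) 'M[F]_m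
  diff_mx diff_mx_is_monoid_morphism.

(** Serves to compute the dimension of D over K, whereas [diff_mx] gives it over L_dif. *)
Definition diff_ev (d : subvs_of (diffops L)) : {ffun 'I_m -> L} :=
  [ffun i : 'I_m => (vsval d : E) b`_i].

Fact diff_ev_is_linear : linear diff_ev.
Proof.
by move=> a d e; apply/ffunP=> i; rewrite !ffunE add_lfunE scale_lfunE.
Qed.
HB.instance Definition _ := GRing.isLinear.Build K (subvs_of (diffops L))
  {ffun 'I_m -> L} _ diff_ev diff_ev_is_linear.

(** D is stable under left multiplication by L, so the dual operators may be combined with arbitrary
    coefficients v_i in L. *)
Lemma diffops_interpolate (v : 'I_m -> L) :
  exists d : diffalg L, forall j : 'I_m, diff_fun d b`_j = v j.
Proof.
have [d dP] := dual_basis_exists.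
have Dd : \sum_i mulop (v i) * d i \in diffops L.
  by apply: memv_suml => i _; rewrite memvM ?mulop_diff //; have [] := dP i.
exists (Subvs Dd) => j; rewrite /= sum_lfunE (bigD1 j) //= big1 => [|i ne_ij].
  by rewrite addr0 endo_mulE mulopE; have [_ ->] := dP j; rewrite eqxx mulr1.
rewrite endo_mulE mulopE; have [_ ->] := dP i.
by rewrite (negPf ne_ij) mulr0.
Qed.

Lemma diffalg_eq (d e : diffalg L) :
  (forall j : 'I_m, diff_fun d b`_j = diff_fun e b`_j) -> d = e.
Proof.
move=> de; apply: diff_fun_inj.
by apply: Ldif_linear_eq de; apply: diff_fun_Ldif_linear.
Qed.

(** An L_dif-linear f is determined by its values on the basis, and interpolation finds a member of
    D with the same values. *)
Lemma diffops_endo_over (f : E) : f \in diffops L <-> endo_over (Ldif L) f.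
Proof.
rewrite endo_overP; split=> [Df c Mc x | lin_f].
  exact: diffops_Ldif_linear.
have [d df] := diffops_interpolate (fun j => f b`_j).
suffices -> : f = diff_fun d by apply: diff_fun_in.
by apply: Ldif_linear_eq => //; apply: diff_fun_Ldif_linear.
Qed.

Lemma diff_mx_bij : bijective diff_mx.
Proof.
apply: bij_of_inj_surj => [d e /matrixP de | A].
  apply: diffalg_eq => j.
  have := coord_vbasis (memvf (diff_fun d b`_j : LM)) => ->.
  have := coord_vbasis (memvf (diff_fun e b`_j : LM)) => ->.
  by apply: eq_bigr => i _; have := de i j; rewrite !mxE => ->.
have [d dA] := diffops_interpolate (fun j => \sum_i A i j *: (b`_i : LM)).
exists d; apply/matrixP=> i j.
by rewrite mxE dA coord_sum_free ?(basis_free (vbasisP _)).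
Qed.

Lemma diff_ev_bij : bijective diff_ev.
Proof.
apply: bij_of_inj_surj => [d e /ffunP de | v].
  by apply: diffalg_eq => j; have := de j; rewrite !ffunE.
have [d dv] := diffops_interpolate v; exists d.
by apply/ffunP=> j; rewrite ffunE -dv.
Qed.

Lemma dim_diffalg : \dim {:diffalg L} = (m ^ 2)%N.
Proof. by rewrite (dim_bij_linear diff_mx_bij) dimvf dim_matrix. Qed.

(** Over K, D is isomorphic to L^m through [diff_ev], and L has dimension m [L_dif : K]. *)
Lemma dim_diffops : \dim (diffops L) = (m ^ 2 * \dim (Ldif L))%N.
Proof.
have -> : \dim (diffops L) = \dim {:subvs_of (diffops L)} by rewrite dimvf.
have dimL : \dim {:L} = (m * \dim (Ldif L))%N.
  by rewrite dim_fieldOver_Ldif divnK // field_dimS ?subvf.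
by rewrite (dim_bij_linear diff_ev_bij) dim_ffun card_ord dimL mulnA.
Qed.

(** * Centralisers and centre inside E(L/K) *)

Lemma centraliser_diffops : 'C(diffops L)%VS = mulopv (Ldif L).
Proof.
apply/vspaceP=> f; apply/idP/mulopvP => [/centvP Cf | [c /LdifP Cc ->]].
  (* Commuting with multiplication by x and evaluating at 1 gives f x = x f(1). *)
  have fE : f = mulop (f 1).
    apply/lfunP=> x.
    have /(congr1 (fun g : E => g 1)) := Cf _ (mulop_diff x).
    by rewrite !endo_mulE !mulopE mulr1 mulrC.
  exists (f 1) => //; apply/LdifP=> g /diffopsP Dg.
  by rewrite -fE Cf.
by apply/centvP=> g /diffopsP Dg; apply: Cc.
Qed.

(** Commuting with multiplications by L_dif means being L_dif-linear, and such operators make up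
    D. *)
Lemma centraliser_Ldif : 'C(mulopv (Ldif L))%VS = diffops L.
Proof.
apply/vspaceP=> f; apply/centvP/idP=> [Cf | Df g /mulopvP[c Mc ->]].
  apply/diffops_endo_over/endo_overP => c Mc x.
  have /Cf/(congr1 (fun g : E => g x)) : mulop c \in mulopv (Ldif L).
    by apply/mulopvP; exists c.
  by rewrite !endo_mulE !mulopE.
apply/lfunP=> x; rewrite !endo_mulE !mulopE.
exact: diffops_Ldif_linear.
Qed.

Lemma center_diffops : 'Z(diffops L)%VS = mulopv (Ldif L).
Proof.
rewrite /center_vspace centraliser_diffops; apply/capv_idPr.
by apply/subvP=> f /mulopvP[c _ ->]; apply: mulop_diff.
Qed.

(** * D as a central simple L_dif-algebra with maximal subfield L *)

Lemma mulD_Ldif (c : F) : mulD (vsval c) = c%:A.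
Proof. by rewrite diffalg_scaleE mulr1. Qed.

Lemma center_diffalg : 'Z({:diffalg L})%VS = 1%VS.
Proof.
apply/vspaceP=> z; apply/idP/idP => [/memv_capP[_ /centvP Cz] | /vlineP[c ->]].
  have : diff_fun z \in 'C(diffops L)%VS.
    apply/centvP=> f Df.
    have := Cz (Subvs Df : diffalg L) (memvf _).
    exact: (congr1 (@diff_fun K L)).
  rewrite centraliser_diffops => /mulopvP[c Mc zc].
  apply/vlineP; exists (Subvs Mc); rewrite -mulD_Ldif.
  by apply: diff_fun_inj; rewrite mulDE.
apply/memv_capP; split; first exact: memvf.
by apply/centvP=> d _; rewrite -scalerAl -scalerAr mul1r mulr1.
Qed.

(* A nonzero x in I sends some y to x y != 0; as rank one operators b_j |->
   delta_ij y lie in D, I contains b_j |-> delta_ij b_i, whose sum is 1. *)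
Lemma simple_ring_diffalg : simple_ring (diffalg L).
Proof.
move=> I [I0 ID IM].
have [I_triv | /not_all_ex_not[x I_x]] := classic (forall x, I x -> x = 0).
  by left.
right; have [Ix nz_x] := imply_to_and _ _ I_x.
have [y nz_xy] : exists y, diff_fun x y != 0.
  apply: NNPP => no_y; apply: nz_x; apply: diff_fun_inj; apply/lfunP=> y.
  rewrite [RHS]lfunE; apply/eqP; apply: contra_notT no_y => nz_xy.
  by exists y.
have I1 : I 1.
  have [e eP] : exists e : 'I_m -> diffalg L, forall i, I (e i) /\
      forall j : 'I_m, diff_fun (e i) b`_j = (i == j)%:R * b`_i.
    apply: (fin_all_exists (P := fun i (e : diffalg L) => I e /\
      forall j : 'I_m, diff_fun e b`_j = (i == j)%:R * b`_i)) => i.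
    have [d db] := diffops_interpolate (fun j => (i == j)%:R * y).
    exists (@mulD K L (b`_i / diff_fun x y) * x * d); split; first exact: IM.
    move=> j; rewrite !diff_funM !endo_mulE mulDE mulopE db.
    case: eqP => _; first by rewrite !mul1r divfK.
    by rewrite !mul0r linear0 mulr0.
  have -> : 1 = \sum_i e i.
    apply: diffalg_eq => j.
    rewrite diff_fun1 endo_oneE diff_fun_sum sum_lfunE (bigD1 j) //=.
    have [_ ->] := eP j; rewrite eqxx mul1r big1 ?addr0 // => i ne_ij.
    by have [_ ->] := eP i; rewrite (negPf ne_ij) mul0r.
  by apply: big_ind => // i _; case: (eP i).
by move=> z; have := IM z 1 1 I1; rewrite !mulr1.
Qed.

Lemma central_simple_diffalg : central_simple (diffalg L).
Proof. by split; [apply: center_diffalg | apply: simple_ring_diffalg]. Qed.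

Lemma Deg_diffalg : Deg (diffalg L) = m%:R.
Proof. by rewrite /Deg dim_diffalg natrX exprCK ?ler0n. Qed.

Lemma Max_s_L_in_D : Max_s (L_in_D L).
Proof.
split; last first.
  (* [mulD] is injective, so the image of L keeps its L_dif-dimension m. *)
  rewrite Deg_diffalg limg_dim_eq //; apply/eqP; rewrite capfv.
  apply/lker0P=> x y; rewrite !lfunE => /(congr1 (@diff_fun K L)).
  by rewrite !mulDE => /mulop_inj.
split.
- apply/subvP=> _ /vlineP[c ->]; apply/L_in_DP.
  by exists (vsval c); rewrite mulD_Ldif.
- move=> _ _ /L_in_DP[x ->] /L_in_DP[y ->]; apply/L_in_DP.
  by exists (x * y); rewrite mulDM.
- by move=> _ _ /L_in_DP[x ->] /L_in_DP[y ->]; rewrite -!mulDM mulrC.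
- move=> _ /L_in_DP[x ->] nz_x; exists (mulD x^-1).
    by apply/L_in_DP; exists x^-1.
  rewrite -mulDM mulfV ?mulD1 //; apply: contraNneq nz_x => ->.
  by apply/eqP/diff_fun_inj; rewrite mulDE rmorph0.
Qed.

(** * L as a D-module *)

Lemma mulD_scale (l : L) (x : diffmod L) : mulD l *: x = l * x :> L.
Proof. by rewrite diffmod_scaleE mulDE mulopE. Qed.

(** Multiplication by y / x belongs to D and carries a nonzero x to any y. *)
Lemma simple_diffmod : simple_module (diffmod L).
Proof.
split=> [|S [S0 SZ]]; first by exists (1 : L); apply: oner_neq0.
have [S_triv | /not_all_ex_not[x S_x]] := classic (forall x, S x -> x = 0).
  by left.
right=> y; have [Sx /eqP nz_x] := imply_to_and _ _ S_x.
have := SZ (mulD (y / x : L)) _ _ Sx S0.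
by rewrite addr0 mulD_scale divfK.
Qed.

(** A D-linear map commutes with multiplications, hence is multiplication by its value at 1;
    commuting with all of D puts that value in L_dif. *)
Lemma linear_diffmodP (f : diffmod L -> diffmod L) :
  linear f <-> exists2 c : L, c \in Ldif L & forall x : L, f x = c * x.
Proof.
split=> [lin_f | [c Mc fc] d x y].
  have fZ (d : diffalg L) (x : L) : f (diff_fun d x) = diff_fun d (f x).
    have f0 : f 0 = 0.
      have := lin_f 1 0 0; rewrite !scale1r !addr0 => /eqP.
      by rewrite -subr_eq subrr eq_sym => /eqP.
    by have := lin_f d x 0; rewrite f0 !addr0.
  have fE (x : L) : f x = (f 1 : L) * x.
    by have := fZ (mulD x) 1; rewrite !mulDE !mulopE mulr1 mulrC.
  exists (f 1) => //; apply: Ldif_of_linear => d x Dd.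
  by rewrite -!fE; apply: esym (fZ (Subvs Dd) x).
rewrite !fc diffmod_scaleE [LHS]mulrDr.
by congr (_ + _); rewrite -diff_fun_Ldif_linear // -fc.
Qed.

(* With e_i in D dual to the basis b, x |-> (x e_i) v is D-linear, and it is
   nonzero for some i because v is the sum of the (b_i e_i) v. *)
Lemma simple_module_iso_diffmod (V : lmodType (diffalg L)) :
  simple_module V -> module_iso V (diffmod L).
Proof.
move=> [[v nz_v] simpleV].
have [e eP] : exists e : 'I_m -> diffalg L, forall i (j : 'I_m),
    diff_fun (e i) b`_j = (i == j)%:R.
  apply: (fin_all_exists (P := fun i (e : diffalg L) => forall j : 'I_m,
    diff_fun e b`_j = (i == j)%:R)) => i.
  exact: (diffops_interpolate (fun j => (i == j)%:R)).
have e1 : \sum_(i : 'I_m) @mulD K L b`_i * e i = 1.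
  apply: diffalg_eq => j.
  rewrite diff_fun1 endo_oneE diff_fun_sum sum_lfunE (bigD1 j) //=.
  rewrite big1 => [|i ne_ij]; rewrite endo_mulE mulopE eP.
    by rewrite eqxx mulr1 addr0.
  by rewrite (negPf ne_ij) mulr0.
have [i nz_ev] : exists i, e i *: v != 0.
  apply: NNPP => no_i; case/eqP: nz_v.
  rewrite -[v]scale1r -e1 scaler_suml big1 // => i _.
  rewrite -scalerA; have [-> | nz_ev] := eqVneq (e i *: v) 0.
    by rewrite scaler0.
  by case: no_i; exists i.
pose g (x : diffmod L) : V := (mulD x * e i) *: v.
have lin_g : linear g.
  move=> d x y; rewrite /g scalerA -scalerDl; congr (_ *: v).
  (* It remains that [mulD (d *: x) * e i = d * mulD x * e i]: both send b_i to d x and the other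
     b_j to 0. *)
  rewrite mulDD mulrDl mulrA; congr (_ + _); apply: diffalg_eq => j.
  rewrite !diff_funM !endo_mulE !mulDE !mulopE eP diffmod_scaleE.
  by case: (i == j); rewrite ?mulr1 // !mulr0 linear0.
pose G := HB.pack_for {linear diffmod L -> V} g
  (GRing.isLinear.Build _ _ _ _ g lin_g).
have g_inj : injective G.
  (* The kernel is a submodule of the simple module L and misses 1, since g 1 = e_i v is nonzero. *)
  have [_ /(_ (fun x => G x = 0))[]] := simple_diffmod.
  - by split=> [|a x y Gx Gy]; rewrite ?linear0 // linearP Gx Gy scaler0 addr0.
  - move=> kerG x y Gxy; apply/eqP; rewrite -subr_eq0; apply/eqP/kerG.
    by rewrite linearB Gxy subrr.
  by move/(_ (1 : L)) => /= g1; case/eqP: nz_ev; rewrite -g1 /g mulD1 mul1r.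
have g_surj w : exists x, G x = w.
  (* The image is a submodule of V containing the nonzero vector e_i v, so it is all of V. *)
  have [| triv | //] := simpleV (fun w => exists x, G x = w).
    split; first by exists 0; rewrite linear0.
    by move=> a _ _ [x <-] [y <-]; exists (a *: x + y); rewrite linearP.
  case/eqP: nz_ev; apply: triv; exists (1 : L).
  by rewrite /= /g mulD1 mul1r.
have [f fK gK] := bij_of_inj_surj g_inj g_surj.
have lin_f : linear f by apply: can2_linear fK gK.
exists (HB.pack_for {linear V -> diffmod L} f
  (GRing.isLinear.Build _ _ _ _ f lin_f)).
by exists G.
Qed.

End Density.

Theorem theorem3p6 (K : fieldType) (p : nat) (charK : p \in [pchar K])
    (L : fieldExtType K) :
  let n := \dim_(Ldif L) {:L} in
  [/\ forall f : endo L, f \in diffops L <-> endo_over (Ldif L) f,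
      exists phi : {lrmorphism diffalg L -> 'M[subvs_of (Ldif L)]_n},
        bijective phi,
      central_simple (diffalg L),
      Deg (diffalg L) = n%:R
    & \dim (diffops L) = (n ^ 2 * \dim (Ldif L))%N] /\
  Max_s (L_in_D L) /\
  'Z(diffops L)%VS = mulopv (Ldif L) /\
  (simple_module (diffmod L) /\
   forall V : lmodType (diffalg L),
     simple_module V -> module_iso V (diffmod L)) /\
  (forall f : diffmod L -> diffmod L,
     linear f <-> exists2 c : L, c \in Ldif L & forall x : L, f x = c * x) /\
  ('C(diffops L)%VS = mulopv (Ldif L) /\
   'C(mulopv (Ldif L))%VS = diffops L).
Proof.
move=> n; rewrite {}/n -dim_fieldOver_Ldif.
split.
  split.
  - exact: diffops_endo_over.
  - by exists (@diff_mx K L); apply: diff_mx_bij.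
  - exact: central_simple_diffalg.
  - exact: Deg_diffalg.
  - exact: dim_diffops.
split; first exact: Max_s_L_in_D.
split; first exact: center_diffops.
split.
  by split; [apply: simple_diffmod | apply: simple_module_iso_diffmod].
split; first exact: linear_diffmodP.
by split; [apply: centraliser_diffops | apply: centraliser_Ldif].
Qed.
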